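(* Let $n\ge2$, $M_n=\frac12n(n-1)$, let $X$ be a vector space over $\mathbb{K}\in\{\mathbb{R},\mathbb{C}\}$ and let $(Y,\|\cdot\|)$ be a normed space over $\mathbb{K}$. Let $A:X^{M_n}\to Y$ be $M_n$-linear and symmetric. Then $$d(x_1,\ldots,x_n)=\Big\|A\Big(\prod_{1\le j<i\le n}(x_i-x_j)\Big)\Big\|,\qquad x_1,\ldots,x_n\in X,$$ defines a pseudo $n$-metric on $X$.
   Context: Since $A$ is symmetric (invariant under permutations of its arguments), its list of $M_n$ arguments is written as a formal product: $A\big(\prod_{1\le j<i\le n}(x_i-x_j)\big)$ denotes the value of $A$ at the $M_n$ vectors $x_i-x_j$, $1\le j<i\le n$, in any order. For $n\ge2$ and a set $X$, a map $d:X^n\to\mathbb{R}$ is a pseudo $n$-metric on $X$ if (i) $d(x_1,\ldots,x_n)=0$ whenever $x_i=x_j$ for some $i\ne j$; (ii) $d(x_{\pi(1)},\ldots,x_{\pi(n)})=d(x_1,\ldots,x_n)$ for all permutations $\pi$ of $\{1,\ldots,n\}$; (iii) $d(x_1,\ldots,x_n)\le\sum_{i=1}^n d(x_1,\ldots,x_{i-1},y,x_{i+1},\ldots,x_n)$ for all $x_1,\ldots,x_n,y\in X$. *)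

(* Defs.v *)
From mathcomp Require Import all_boot all_algebra all_fingroup.
From mathcomp Require Import mathcomp_extra boolp reals normedtype.
From mathcomp Require Import complex.

Set Implicit Arguments.
Unset Strict Implicit.
Unset Printing Implicit Defensive.

Import GRing.Theory.

Local Open Scope ring_scope.

Definition multilinear (K : pzRingType) (X Y : lmodType K) (m : nat)
    (A : ('I_m -> X) -> Y) : Prop :=
  forall (v : 'I_m -> X) (k : 'I_m),
    linear (fun u : X => A (dfwith v k u)).

Definition symmetric_map (X Y : Type) (m : nat) (A : ('I_m -> X) -> Y) : Prop :=
  forall (s : {perm 'I_m}) (v : 'I_m -> X), A (fun k => v (s k)) = A v.

Record pseudo_n_metric (R : realType) (X : Type) (n : nat)
    (d : ('I_n -> X) -> R) : Prop := PseudoNMetric {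
  pseudo_n_metric_eq0 :
    forall (x : 'I_n -> X) (i j : 'I_n), i != j -> x i = x j -> d x = 0;
  pseudo_n_metric_sym : symmetric_map d;
  pseudo_n_metric_ineq :
    forall (x : 'I_n -> X) (y : X),
      d x <= \sum_(i < n) d (dfwith x i y) }.

Definition M (n : nat) : nat := ((n * n.-1)./2)%N.

Definition index_pairs (n : nat) : {set 'I_n * 'I_n} :=
  [set p : 'I_n * 'I_n | (p.2 < p.1)%N].

Lemma card_index_pairs n : #|index_pairs n| = M n.
Proof.
rewrite /M -bin2 -bin2_sum -sum1_card big_mkord.
rewrite (eq_bigr (fun i : 'I_n => \sum_(j < n | (j < i)%N) 1)%N).
  by rewrite pair_big_dep /=; apply: eq_bigl => p; rewrite inE.
move=> i _; rewrite (big_ord_narrow (ltnW (ltn_ord i))).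
by rewrite sum1_card card_ord.
Qed.

Definition nth_pair (n : nat) (k : 'I_(M n)) : 'I_n * 'I_n :=
  enum_val (cast_ord (esym (card_index_pairs n)) k).

Definition differences (X : zmodType) (n : nat) (x : 'I_n -> X) :
    'I_(M n) -> X :=
  fun k => x (nth_pair k).1 - x (nth_pair k).2.

(* The enumeration chosen in [nth_pair] is immaterial for a symmetric map. *)
Lemma differences_any_order (X : zmodType) (Y : Type) (n : nat)
    (A : ('I_(M n) -> X) -> Y) (e : 'I_(M n) -> 'I_n * 'I_n) (x : 'I_n -> X) :
  symmetric_map A -> injective e -> (forall k, e k \in index_pairs n) ->
  A (fun k => x (e k).1 - x (e k).2) = A (differences x).
Proof.
move=> symA inj_e eP.
pose s k := cast_ord (card_index_pairs n) (enum_rank_in (eP k) (e k)).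
have sE k : nth_pair (s k) = e k.
  by rewrite /nth_pair /s cast_ordK enum_rankK_in.
have inj_s : injective s by move=> k l skl; apply: inj_e; rewrite -!sE skl.
rewrite -[RHS](symA (perm inj_s)); congr A; apply/funext => k.
by rewrite /differences permE sE.
Qed.

(* Main.v *)
(* A symmetric multilinear map factors through the degree-m part of a polynomial
   ring, so the value of A at the differences x_i - x_j is a linear image of the
   Vandermonde determinant in the variables attached to the x_i, and identities
   between Vandermonde determinants transfer to A.  The simplex inequality comes
   from the identity  V(x) = \sum_k V(x with x_k replaced by y),  which is
   Cramer's rule: the right-hand side is (1 ... 1) adj(V) w for the column
   w = (y^i), and (1 ... 1) is the first row of V, so (1 ... 1) adj(V) is
   det V times the first unit row. *)

Require Import Defs.
From HB Require Import structures.
From mathcomp Require Import all_boot all_order all_algebra all_fingroup.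
From mathcomp Require Import mathcomp_extra boolp.
From mathcomp Require mpoly.

Set Implicit Arguments.
Unset Strict Implicit.
Unset Printing Implicit Defensive.

Import Order.TTheory GRing.Theory Num.Theory.

Local Open Scope ring_scope.

Lemma sum_scale_delta (K : pzRingType) (V : lmodType K) (I : finType)
    (u : I -> V) (i : I) :
  \sum_j (j == i)%:R *: u j = u i.
Proof.
rewrite (bigD1 i) //= eqxx scale1r big1 ?addr0 // => j /negPf->.
by rewrite scale0r.
Qed.

Lemma multilinear_sum (K : pzRingType) (X Y : lmodType K) (m : nat)
    (A : ('I_m -> X) -> Y) (I : finType) (v : 'I_m -> X) (k : 'I_m)
    (a : I -> K) (u : I -> X) :
  multilinear A ->
  A (dfwith v k (\sum_i a i *: u i)) = \sum_i a i *: A (dfwith v k (u i)).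
Proof.
move=> /(_ v k) linA.
pose f : {linear X -> Y} :=
  HB.pack (fun w : X => A (dfwith v k w)) (GRing.isLinear.Build _ _ _ _ _ linA).
rewrite -[LHS]/(f _) linear_sum; apply: eq_bigr => i _; exact: linearZ.
Qed.

Lemma vandermonde_exchange (R : comPzRingType) (n : nat) (x : 'I_n -> R)
    (y : R) : (0 < n)%N ->
  \det (Vandermonde n (\row_i x i)) =
  \sum_(k < n) \det (Vandermonde n (\row_i dfwith x k y i)).
Proof.
case: n x => // n x _; set V := Vandermonde _ _.
have rowV : row 0 V = const_mx 1 by apply/rowP => j; rewrite !mxE expr0.
pose w : 'cV[R]_n.+1 := \col_i y ^+ i.
(* Laplace expansion along column [k]: its entries are those of [w], and the cofactors do not see
   that column. *)
have detE k :
    \det (Vandermonde n.+1 (\row_i dfwith x k y i)) = (\adj V *m w) k 0.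
  rewrite (expand_det_col _ k) mxE; apply: eq_bigr => i _.
  rewrite !mxE dfwithin mulrC; congr (_ * _).
  rewrite /cofactor; congr (_ * \det _); apply/matrixP => a b.
  by rewrite !mxE dfwithout // neq_lift.
transitivity ((row 0 V *m \adj V *m w) 0 0).
  by rewrite -!row_mul mul_mx_adj mul_scalar_mx !mxE expr0 mulr1.
rewrite -mulmxA rowV mxE; apply: eq_bigr => k _.
by rewrite detE mxE mul1r.
Qed.

(* [mpoly] and [normedtype] declare incompatible notation levels: the import of
   the former must not escape this section. *)
Section SymmetricFactorization.
Import mathcomp.multinomials.mpoly.

(** The exponents of the monomial count how often each index occurs in the family. *)
Lemma eq_mnm_sum_perm (m N : nat) (f g : 'I_m -> 'I_N) :
  (\sum_k U_(f k) = \sum_k U_(g k))%MM ->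
  exists s : {perm 'I_m}, f =1 g \o s.
Proof.
move=> eq_fg.
have countE (h : 'I_m -> 'I_N) j :
    count_mem j [tuple h k | k < m] = (\sum_k U_(h k))%MM j.
  rewrite mnm_sumE count_map -sum1_count big_enum_cond big_mkcond /=.
  by apply: eq_bigr => k _; rewrite mnm1E; case: (h k == j).
have /tuple_permP[s fs] : perm_eq [tuple f k | k < m] [tuple g k | k < m].
  by apply/allP => j _ /=; rewrite !countE eq_fg.
exists s => k /=.
have /val_inj/(congr1 (fun t => tnth t k)) := fs.
by rewrite !tnth_mktuple.
Qed.

(** [L] sends the degree-[m] monomial with indices [f] to [A (z \o f)], which is well defined by
    symmetry. Since [L] does not depend on [c], it transfers polynomial identities to [A]. *)
Lemma symmetric_multilinear_factor (K : comNzRingType) (X Y : lmodType K)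
    (m N : nat) (A : ('I_m -> X) -> Y) (z : 'I_N -> X) :
  multilinear A -> symmetric_map A ->
  exists (S : comAlgType K) (T : 'I_N -> S) (L : {linear S -> Y}),
    forall c : 'I_m -> 'I_N -> K,
      A (fun k => \sum_j c k j *: z j) = L (\prod_k \sum_j c k j *: T j).
Proof.
move=> linA symA.
(* The default 0 is taken exactly at the monomials of degree other than [m]. *)
pose g (mu : 'X_{1..N}) : Y :=
  if [pick f : {ffun 'I_m -> 'I_N} | (\sum_k U_(f k))%MM == mu] is Some f
  then A (z \o f) else 0.
have gE (f : 'I_m -> 'I_N) : g (\sum_k U_(f k))%MM = A (z \o f).
  rewrite /g; case: pickP => [h /eqP/eq_mnm_sum_perm[s hs]|/(_ (finfun f))].
    by rewrite -(symA s (z \o f)); congr A; apply/funext => k; rewrite /= hs.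
  by rewrite /= (eq_bigr (fun k => U_(f k))%MM) ?eqxx // => k _; rewrite ffunE.
pose Lf (p : {mpoly K[N]}) : Y := \sum_(mu : 'X_{1..N < m.+1}) p@_mu *: g mu.
have linL : linear Lf.
  move=> a p q; rewrite /Lf scaler_sumr -big_split; apply: eq_bigr => mu _ /=.
  by rewrite mcoeffD mcoeffZ scalerDl scalerA.
have [L LX] : exists L : {linear {mpoly K[N]} -> Y},
    forall f : 'I_m -> 'I_N, L (\prod_k 'X_(f k)) = A (z \o f).
  pose L : {linear {mpoly K[N]} -> Y} :=
    HB.pack Lf (GRing.isLinear.Build _ _ _ _ _ linL).
  exists L => f; rewrite -[L _]/(Lf _).
  rewrite -gE mprodXE; set mu := (\sum_k _)%MM.
  have lt_mu : (mdeg mu < m.+1)%N.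
    rewrite mdeg_sum (eq_bigr (fun=> 1%N)) => [|k _]; last by rewrite mdeg1.
    by rewrite sum1_card card_ord.
  rewrite /Lf (bigD1 (BMultinom lt_mu)) //= mcoeffX eqxx scale1r.
  rewrite big1 ?addr0 // => nu; rewrite bmeqP eq_sym mcoeffX /= => /negPf->.
  by rewrite scale0r.
exists {mpoly K[N]}, (fun j => 'X_j), L => c.
pose delta j : 'I_N -> K := fun i => (i == j)%:R.
have deltaE (V : lmodType K) (u : 'I_N -> V) j : \sum_i delta j i *: u i = u j.
  exact: sum_scale_delta.
(* Induction on the coordinates whose argument is not yet one of the z j. *)
have: forall k, k \notin enum 'I_m -> exists j, c k = delta j.
  by move=> k; rewrite mem_enum.
elim: (enum _) c => [|k s IHs] c.
  move=> /(_ _ isT) cE; have /fin_all_exists[f {}cE] := cE.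
  transitivity (A (z \o f)).
    by congr A; apply/funext => k; rewrite cE deltaE.
  by rewrite -LX; congr (L _); apply: eq_bigr => k _; rewrite cE deltaE.
move=> cE; pose cj j := dfwith c k (delta j).
have cjE j k' : k' \notin s -> exists i, cj j k' = delta i.
  rewrite /cj; case: dfwithP => [|i ne_ki i_s]; first by exists j.
  by apply: cE; rewrite inE negb_or eq_sym ne_ki.
set v := (X in A X).
have {1}-> : v = dfwith v k (\sum_j c k j *: z j).
  by apply/funext => i; case: dfwithP.
(* Both sides expand linearly in argument [k]; in the [j]-th term that argument has become [z j]. *)
rewrite multilinear_sum // (bigD1 k) //= mulr_suml linear_sum.
apply: eq_bigr => j _; rewrite -scalerAl linearZ; congr (_ *: _).
transitivity (A (fun k' => \sum_i cj j k' i *: z i)).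
  congr A; apply/funext => k'; rewrite /cj /v.
  by case: dfwithP => [|i ne_ki]; rewrite ?dfwithin ?deltaE ?dfwithout.
rewrite (IHs _ (cjE j)) (bigD1 k) //= {1}/cj dfwithin deltaE; congr (L (_ * _)).
by apply: eq_bigr => i ne_ik; rewrite /cj dfwithout // eq_sym.
Qed.

End SymmetricFactorization.

Lemma differences_vandermonde (K : comNzRingType) (X Y : lmodType K)
    (n N : nat) (A : ('I_(M n) -> X) -> Y) (z : 'I_N -> X) :
  multilinear A -> symmetric_map A ->
  exists (S : comAlgType K) (T : 'I_N -> S) (L : {linear S -> Y}),
    forall s : 'I_n -> 'I_N,
      A (differences (z \o s)) = L (\det (Vandermonde n (\row_i T (s i)))).
Proof.
move=> linA symA.
have [S [T [L AE]]] := symmetric_multilinear_factor z linA symA.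
exists S, T, L => s.
(* Coordinates of the [k]-th difference with respect to the family [z]. *)
pose c k j : K := (j == s (@nth_pair n k).1)%:R - (j == s (nth_pair k).2)%:R.
have cE (V : lmodType K) (u : 'I_N -> V) k :
    \sum_j c k j *: u j = u (s (nth_pair k).1) - u (s (nth_pair k).2).
  rewrite -[u (s _) in RHS]sum_scale_delta -[X in _ - X]sum_scale_delta -sumrB.
  by apply: eq_bigr => j _; rewrite scalerBl.
transitivity (A (fun k => \sum_j c k j *: z j)).
  by congr A; apply/funext => k; rewrite cE.
rewrite AE (eq_bigr _ (fun k _ => cE _ T k)); congr (L _).
rewrite det_Vandermonde pair_big_dep /=.
pose F (p : 'I_n * 'I_n) := T (s p.1) - T (s p.2).
transitivity (\prod_(p in index_pairs n) F p).
  rewrite [RHS]big_enum_val (reindex (cast_ord (card_index_pairs n))) /=.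
    by apply: eq_bigr => k _; rewrite /nth_pair cast_ordK.
  by apply: onW_bij; exists (cast_ord (esym (card_index_pairs n)));
    [exact: cast_ordK | exact: cast_ordKV].
(* The Vandermonde product puts the smaller index first, [index_pairs] the larger one. *)
have swapK : involutive (fun p : 'I_n * 'I_n => (p.2, p.1)) by case.
rewrite (reindex_inj (inv_inj swapK)) /=.
by apply: eq_big => [p|p _]; rewrite ?inE ?mxE.
Qed.

Lemma differences_eq0 (K : comNzRingType) (X Y : lmodType K) (n : nat)
    (A : ('I_(M n) -> X) -> Y) (x : 'I_n -> X) (i j : 'I_n) :
  multilinear A -> symmetric_map A ->
  i != j -> x i = x j -> A (differences x) = 0.
Proof.
move=> linA symA neq_ij eq_x.
have [S [T [L AE]]] := differences_vandermonde x linA symA.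
(* Reading [x j] as [x i] gives the Vandermonde matrix two equal columns. *)
pose s k := if k == j then i else k.
have -> : x = x \o s.
  by apply/funext => k; rewrite /s /=; case: eqP => [->|].
rewrite AE -det_tr (determinant_alternate neq_ij) ?linear0 // => k.
by rewrite !mxE /s eqxx (negPf neq_ij).
Qed.

Lemma differences_perm (K : comNzRingType) (X Y : lmodType K) (n : nat)
    (A : ('I_(M n) -> X) -> Y) (x : 'I_n -> X) (s : {perm 'I_n}) :
  multilinear A -> symmetric_map A ->
  A (differences (x \o s)) = (-1) ^+ s *: A (differences x).
Proof.
move=> linA symA.
have [S [T [L AE]]] := differences_vandermonde x linA symA.
rewrite AE -[x in RHS]/(x \o id) AE -linearZ; congr (L _).
have -> : Vandermonde n (\row_i T (s i)) =
    col_perm s (Vandermonde n (\row_i T i)).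
  by apply/matrixP => i j; rewrite !mxE.
by rewrite col_permE det_mulmx det_perm odd_permV mulrC mulr_sign scaler_sign.
Qed.

Lemma differences_exchange (K : comNzRingType) (X Y : lmodType K) (n : nat)
    (A : ('I_(M n) -> X) -> Y) (x : 'I_n -> X) (y : X) :
  multilinear A -> symmetric_map A -> (0 < n)%N ->
  A (differences x) = \sum_(i < n) A (differences (dfwith x i y)).
Proof.
(* [z] lists [y] first and then [x], so a single [L] serves all the families in the identity. *)
move=> linA symA n_gt0; pose z (j : 'I_n.+1) := oapp x y (unlift ord0 j).
have [S [T [L AE]]] := differences_vandermonde z linA symA.
have xE : x = z \o lift ord0.
  by apply/funext => j; rewrite /z /= liftK.
rewrite [in LHS]xE AE (vandermonde_exchange _ (T ord0)) // linear_sum.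
apply: eq_bigr => i _.
have -> : dfwith x i y = z \o dfwith (lift ord0) i ord0.
  apply/funext => j /=; case: dfwithP => [|k ne_ik].
    by rewrite dfwithin /z unlift_none.
  by rewrite dfwithout // /z liftK.
rewrite AE; congr (L (\det (Vandermonde _ _))); apply/rowP => j; rewrite !mxE.
by case: dfwithP => [|k ne_ik]; rewrite ?dfwithin ?dfwithout.
Qed.

From mathcomp Require Import reals normedtype complex.

(** An abstract [N] covers both scalar fields at once; its evenness absorbs the sign of a
    permutation. *)
Lemma differences_pseudo_n_metric (R : realType) (K : comNzRingType)
    (X Y : lmodType K) (n : nat) (A : ('I_(M n) -> X) -> Y) (N : Y -> R) :
  (0 < n)%N -> multilinear A -> symmetric_map A ->
  N 0 = 0 -> (forall u, N (- u) = N u) ->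
  (forall u v, N (u + v) <= N u + N v) ->
  pseudo_n_metric (fun x : 'I_n -> X => N (A (differences x))).
Proof.
move=> n_gt0 linA symA N0 NN ND; split.
- by move=> x i j neq_ij eq_x; rewrite (differences_eq0 linA symA neq_ij eq_x).
- move=> s x; rewrite -[fun k => _]/(x \o s) differences_perm //.
  by rewrite scaler_sign; case: ifP.
- move=> x y; rewrite (differences_exchange x y linA symA n_gt0).
  elim/big_ind2: _ => [|u a v b le_ua le_vb|//]; first by rewrite N0.
  by rewrite (le_trans (ND _ _)) ?lerD.
Qed.

(* For complex scalars the library norm takes its (real, nonnegative) values in
   R[i]; [complex.Re] reads them as elements of R. *)
Theorem corollary6p3 (R : realType) (n : nat) (hn : (2 <= n)%N) :
  (forall (X : lmodType R) (Y : normedModType R) (A : ('I_(M n) -> X) -> Y),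
      multilinear A -> symmetric_map A ->
      pseudo_n_metric (fun x : 'I_n -> X => `|A (differences x)|)) /\
  (forall (X : lmodType R[i]) (Y : normedModType R[i])
          (A : ('I_(M n) -> X) -> Y),
      multilinear A -> symmetric_map A ->
      pseudo_n_metric (fun x : 'I_n -> X => complex.Re `|A (differences x)|)).
Proof.
have n_gt0 := ltnW hn.
split=> X Y A linA symA.
  apply: (@differences_pseudo_n_metric _ _ _ _ _ _ (fun u : Y => `|u|)) => //.
  - exact: normr0.
  - exact: normrN.
  - exact: ler_normD.
pose N (u : Y) := complex.Re `|u|.
apply: (@differences_pseudo_n_metric _ _ _ _ _ _ N) => //; rewrite /N.
- by rewrite normr0.
- by move=> u; rewrite normrN.
(* An inequality in [R[i]] means equal imaginary parts and ordered real parts; the latter is what is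
   kept. *)
- move=> u v; have := ler_normD u v; rewrite lecE => /andP[_].
  by case: `|u| `|v| => [? ?] [? ?].
Qed.
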